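(* Let $(\mathfrak g,\omega_{\mathfrak g})$ be a restricted orthosymplectic quasi-Frobenius Lie superalgebra. Suppose there exists a non-zero $x\in\mathfrak z(\mathfrak g)_{\bar 1}$ such that $\omega_{\mathfrak g}(x,x)=0$. Then $(\mathfrak g,\omega_{\mathfrak g})$ is a $\mathscr D_{\bar 1}$-extension of a restricted orthosymplectic quasi-Frobenius Lie superalgebra $(\mathfrak a,\omega_{\mathfrak a})$.
   Context: $\mathbb K$ is a field of characteristic $p>2$. Lie superalgebras $\mathfrak a=\mathfrak a_{\bar 0}\oplus\mathfrak a_{\bar 1}$ are finite-dimensional over $\mathbb K$; $[u,[u,u]]=0$ for odd $u$ is part of the definition (needed if $p=3$). $|u|$ is the parity of $u$; formulas with parities are for homogeneous elements. $\mathfrak z(\mathfrak g)_{\bar 1}$ is the odd part of the center. A $p$-structure on a Lie algebra $L$ is a map $a\mapsto a^{[p]}$ with $\mathrm{ad}_{a^{[p]}}=(\mathrm{ad}_a)^p$, $(\alpha a)^{[p]}=\alpha^pa^{[p]}$, $(a+b)^{[p]}=a^{[p]}+b^{[p]}+\sum_{i=1}^{p-1}s_i(a,b)$, where $(\mathrm{ad}_{\mu a+b})^{p-1}(a)=\sum_{i=1}^{p-1}i\,s_i(a,b)\mu^{i-1}$. A $p|2p$-map on $\mathfrak a$ is a $p$-structure on $\mathfrak a_{\bar 0}$ with $\mathrm{ad}_{a^{[p]}}(b)=(\mathrm{ad}_a)^p(b)$ for all $a\in\mathfrak a_{\bar 0}$, $b\in\mathfrak a$. $\mathfrak a$ with a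 $p|2p$-map is called restricted. A bilinear form $\omega$ is (super) anti-symmetric if $\omega(a,b)=-(-1)^{|a||b|}\omega(b,a)$, and closed if $(-1)^{|a||c|}\omega(a,[b,c])+(-1)^{|c||b|}\omega(c,[a,b])+(-1)^{|b||a|}\omega(b,[c,a])=0$. $(\mathfrak a,\omega)$ is quasi-Frobenius if $\omega$ is a non-degenerate closed anti-symmetric form; orthosymplectic if $\omega$ is even ($\omega(\mathfrak a_{\bar 0},\mathfrak a_{\bar 1})=\omega(\mathfrak a_{\bar 1},\mathfrak a_{\bar 0})=0$). The adjoint $\mathscr D^*$ of a derivation $\mathscr D$ is defined by $\omega(\mathscr D(a),b)=(-1)^{|a||\mathscr D|}\omega(a,\mathscr D^*(b))$. $\mathscr D$ is restricted if $\mathscr D(a^{[p]})=(\mathrm{ad}_a)^{p-1}(\mathscr D(a))$ for all $a\in\mathfrak a_{\bar 0}$. For an anti-symmetric bilinear $\alpha:\mathfrak a\times\mathfrak a\to\mathbb K$, a map $\beta:\mathfrak a_{\bar 0}\to\mathbb K$ has the $*$-property with respect to $\alpha$ if $\beta(\delta a)=\delta^p\beta(a)$ and $\beta(a+b)=\beta(a)+\beta(b)+\sum\frac1{\pi\{a\}}\alpha([[\dots[x_1,x_2],x_3]\dots,x_{p-1}],x_p)$, the sum over all choices $x_i\in\{a,b\}$ with $x_1=a$, $x_2=b$, $\pi\{a\}$ being the number of $x_i$ equal to $a$. $B^2_*(\mathfrak a;\mathbb K)$ is the set of pairs $(\alpha,\beta)$ such that $\beta$ has the $*$-property with respect to $\alpha$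 and there is a linear $\varphi:\mathfrak a\to\mathbb K$ with $\alpha(a,b)=\varphi([a,b])$, $\beta(a)=\varphi(a^{[p]})$. $\mathscr D_{\bar 1}$-extension (orthosymplectic case). Data: a restricted orthosymplectic quasi-Frobenius $(\mathfrak a,\omega_{\mathfrak a})$ and an odd restricted derivation $\mathscr D$ of $\mathfrak a$ such that, with $\Omega(a,b)=\omega_{\mathfrak a}(\mathscr D^2(a)-(\mathscr D^* )^2(a),b)$ and $\Delta(a)=\omega_{\mathfrak a}((\mathscr D+\mathscr D^* )(a),(\mathrm{ad}_a)^{p-2}(\mathscr D(a)))$ for $a\in\mathfrak a_{\bar 0}$ in the latter, one has $(\Omega,\Delta)\in B^2_*(\mathfrak a;\mathbb K)$, and an element $a_0\in\mathfrak a_{\bar 0}$ with $\Omega(a,b)=\omega_{\mathfrak a}(a_0,[a,b])$, $\Delta(a)=\omega_{\mathfrak a}(a_0,a^{[p]})$, $\mathscr D^2=\mathrm{ad}_{a_0}$, $\mathscr D(a_0)=0$. The extension is $\mathfrak g=\mathbb Kx\oplus\mathfrak a\oplus\mathbb Kx^*$ with $x,x^*$ odd, bracket $[x,\mathfrak g]=0$, $[a,b]_{\mathfrak g}=[a,b]_{\mathfrak a}+(\omega_{\mathfrak a}(\mathscr D(a),b)+(-1)^{|a|}\omega_{\mathfrak a}(a,\mathscr D(b)))x$, $[x^*,x^*]=2a_0$, $[x^*,a]=\mathscr D(a)-\omega_{\mathfrak a}(a,a_0)x$; form $\omega_{\mathfrak g}|_{\mathfrak a\times\mathfrak a}=\omega_{\mathfrak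 a}$, $\omega_{\mathfrak g}(x^*,x)=1$, $\mathfrak a\perp x,x^*$, $\omega_{\mathfrak g}(x,x)=\omega_{\mathfrak g}(x^*,x^* )=0$; and $p|2p$-map $a^{[p]_{\mathfrak g}}=a^{[p]_{\mathfrak a}}$. ''$\mathfrak g$ is a $\mathscr D_{\bar 1}$-extension'' means that $(\mathfrak g,\omega_{\mathfrak g})$ is such an extension up to an isomorphism of restricted Lie superalgebras preserving the forms. *)

(* Defs.v *)
From HB Require Import structures.
From mathcomp Require Import all_boot all_order all_algebra.

Set Implicit Arguments.
Unset Strict Implicit.
Unset Printing Implicit Defensive.

Import GRing.Theory.
Local Open Scope ring_scope.

(* Raw data on a finite-dimensional space V.  The parity i : bool is false for
   even and true for odd, so |a| + |b| is i (+) j and |a||b| is i && j.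
   The p-map is only meaningful on the even part; its values elsewhere are
   junk, and no definition below looks at them. *)
Record superdata (K : fieldType) (V : vectType K) := SuperData {
  spart : bool -> {vspace V};
  sbr : V -> V -> V;
  spm : V -> V;
  sform : V -> V -> K
}.

Section SuperAlgebras.

Variables (K : fieldType) (p : nat) (V : vectType K) (S : superdata V).

Local Notation "[[ a , b ]]" := (sbr S a b) (at level 0).
Local Notation omega := (sform S).
Local Notation ad := (sbr S).

Definition is_superspace : Prop :=
  (spart S false + spart S true)%VS = fullv /\
  (spart S false :&: spart S true)%VS = 0%VS.

Definition is_lie_superalgebra : Prop :=
  [/\ is_superspace,
      bilinear_for *:%R *:%R (sbr S),
      forall i j a b, a \in spart S i -> b \in spart S j ->
        [[a, b]] \in spart S (i (+) j) /\
        [[a, b]] = - ((-1) ^+ (i && j) *: [[b, a]]),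
      forall i j k a b c,
        a \in spart S i -> b \in spart S j -> c \in spart S k ->
        [[a, [[b, c]]]] =
          [[[[a, b]], c]] + (-1) ^+ (i && j) *: [[b, [[a, c]]]]
    & forall u, u \in spart S true -> [[u, [[u, u]]]] = 0].

(* The s_i(a, b) are determined by the identity below: its right-hand side has
   degree p - 2 in mu, and a field of characteristic p has at least p scalars. *)
Definition is_p_structure : Prop :=
  [/\ forall a, a \in spart S false -> spm S a \in spart S false,
      forall a b, a \in spart S false -> b \in spart S false ->
        ad (spm S a) b = iter p (ad a) b,
      forall (t : K) a, a \in spart S false -> spm S (t *: a) = t ^+ p *: spm S a
    & forall a b, a \in spart S false -> b \in spart S false ->
        exists s : nat -> V,
          (forall mu : K, iter p.-1 (ad (mu *: a + b)) a =
             \sum_(1 <= i < p) (i%:R * mu ^+ i.-1) *: s i) /\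
          spm S (a + b) = spm S a + spm S b + \sum_(1 <= i < p) s i].

Definition is_p2p_map : Prop :=
  is_p_structure /\
  forall a b, a \in spart S false -> ad (spm S a) b = iter p (ad a) b.

Definition is_restricted_lie_superalgebra : Prop :=
  is_lie_superalgebra /\ is_p2p_map.

Definition super_antisymmetric (w : V -> V -> K) : Prop :=
  forall i j a b, a \in spart S i -> b \in spart S j ->
    w a b = - ((-1) ^+ (i && j) * w b a).

Definition closed_form (w : V -> V -> K) : Prop :=
  forall i j k a b c,
    a \in spart S i -> b \in spart S j -> c \in spart S k ->
    (-1) ^+ (i && k) * w a [[b, c]] + (-1) ^+ (k && j) * w c [[a, b]] +
    (-1) ^+ (j && i) * w b [[c, a]] = 0.

Definition nondegenerate_form (w : V -> V -> K) : Prop :=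
  forall a, (forall b, w a b = 0) -> a = 0.

Definition even_form (w : V -> V -> K) : Prop :=
  forall i j a b, a \in spart S i -> b \in spart S j -> i != j -> w a b = 0.

Definition is_quasi_frobenius : Prop :=
  [/\ is_lie_superalgebra, bilinear_for *%R *%R omega,
      nondegenerate_form omega, super_antisymmetric omega
    & closed_form omega].

Definition is_restricted_orthosymplectic_qF : Prop :=
  [/\ is_restricted_lie_superalgebra, is_quasi_frobenius & even_form omega].

Definition in_center (x : V) : Prop := forall y, [[x, y]] = 0.

Definition is_derivation (d : bool) (D : 'End(V)) : Prop :=
  (forall i a, a \in spart S i -> D a \in spart S (i (+) d)) /\
  (forall i a b, a \in spart S i ->
     D [[a, b]] = [[D a, b]] + (-1) ^+ (i && d) *: [[a, D b]]).

Definition is_restricted_derivation (d : bool) (D : 'End(V)) : Prop :=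
  is_derivation d D /\
  forall a, a \in spart S false -> D (spm S a) = iter p.-1 (ad a) (D a).

Definition is_adjoint (d : bool) (D Ds : 'End(V)) : Prop :=
  forall i a b, a \in spart S i ->
    omega (D a) b = (-1) ^+ (i && d) * omega a (Ds b).

(* A word w in {a, b} of length p is coded by booleans, true standing for a,
   and x_1, ..., x_p are numbered from 0. *)
Definition star_property (alpha : V -> V -> K) (beta : V -> K) : Prop :=
  (forall (t : K) a, a \in spart S false -> beta (t *: a) = t ^+ p * beta a) /\
  (forall a b, a \in spart S false -> b \in spart S false ->
     beta (a + b) = beta a + beta b +
       \sum_(w : p.-tuple bool | nth false w 0 && ~~ nth true w 1)
         let x i := if nth false w i then a else b in
         (count_mem true w)%:R^-1 *
         alpha (foldl (sbr S) (x 0) [seq x i | i <- iota 1 p.-2]) (x p.-1)).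

Definition in_B2star (alpha : V -> V -> K) (beta : V -> K) : Prop :=
  [/\ bilinear_for *%R *%R alpha, super_antisymmetric alpha,
      star_property alpha beta
    & exists phi : {linear V -> K^o},
        (forall a b, alpha a b = phi [[a, b]]) /\
        (forall a, a \in spart S false -> beta a = phi (spm S a))].

Definition Omega (D Ds : 'End(V)) (a b : V) : K :=
  omega (D (D a) - Ds (Ds a)) b.

Definition Delta (D Ds : 'End(V)) (a : V) : K :=
  omega (D a + Ds a) (iter p.-2 (ad a) (D a)).

Definition is_D1_data (D : 'End(V)) (a0 : V) : Prop :=
  is_restricted_derivation true D /\
  exists2 Ds : 'End(V), is_adjoint true D Ds &
    in_B2star (Omega D Ds) (Delta D Ds) /\
    [/\ a0 \in spart S false,
        forall a b, Omega D Ds a b = omega a0 [[a, b]],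
        forall a, a \in spart S false -> Delta D Ds a = omega a0 (spm S a),
        forall a, D (D a) = [[a0, a]]
      & D a0 = 0].

(* a |-> (-1)^|a| a on homogeneous elements. *)
Definition psign : 'End(V) :=
  (daddv_pi (spart S false) (spart S true) -
   daddv_pi (spart S true) (spart S false))%R.

End SuperAlgebras.

Section Extension.

Variables (K : fieldType) (A : vectType K) (S : superdata A).
Variables (D : 'End(A)) (a0 : A).

Local Notation omega := (sform S).

(* (s, a, t) stands for s x + a + t x^*. *)
Definition D1_space : vectType K := (K^o * A * K^o)%type.

Definition D1_x : D1_space := (1, 0, 0).
Definition D1_in (a : A) : D1_space := (0, a, 0).
Definition D1_xs : D1_space := (0, 0, 1).

Fact D1_in_linear : linear D1_in.
Proof.
by move=> k a b; apply/eqP; rewrite /D1_in !xpair_eqE /= scaler0 addr0 !eqxx.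
Qed.
HB.instance Definition _ :=
  GRing.isLinear.Build K A D1_space _ D1_in D1_in_linear.

Definition D1_part (i : bool) : {vspace D1_space} :=
  (linfun D1_in @: spart S i +
   (if i then <[D1_x]> + <[D1_xs]> else 0))%VS.

(* [x^*, a] and [a, b] in the extension, for a and b in A. *)
Definition D1_xs_bracket (a : A) : D1_space := (- omega a a0, D a, 0).

Definition D1_bracket (a b : A) : D1_space :=
  (omega (D a) b + omega (psign S a) (D b), sbr S a b, 0).

(* Bilinear extension; [a, x^*] = - (-1)^|a| [x^*, a] by anti-symmetry. *)
Definition D1_br (u v : D1_space) : D1_space :=
  let: (_, a, s) := u in let: (_, b, t) := v in
  D1_bracket a b + s *: D1_xs_bracket b - t *: D1_xs_bracket (psign S a) +
  (s * t) *: D1_in (2%:R *: a0).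

(* omega(x, x^* ) = omega(x^*, x) = 1, as x and x^* are both odd. *)
Definition D1_form (u v : D1_space) : K :=
  let: (s, a, t) := u in let: (s', b, t') := v in
  omega a b + t * s' + s * t'.

Definition D1_extension : superdata D1_space :=
  SuperData D1_part D1_br (fun u => D1_in (spm S u.1.2)) D1_form.

Lemma mem_D1_part i u :
  (u \in D1_part i) =
  (u.1.2 \in spart S i) && (i || (u.1.1 == 0) && (u.2 == 0)).
Proof.
case: u => [[s a] t] /=; apply/idP/idP.
  case/memv_addP=> _ /memv_imgP[b Sb ->] [w wP]; rewrite lfunE /=.
  case: i wP Sb => [/memv_addP[_ /vlineP[k ->] [_ /vlineP[l ->] ->]]|].
    by move=> Sb [_ -> _]; rewrite !scaler0 !addr0 Sb.
  by rewrite memv0 => /eqP-> Sb [-> -> ->]; rewrite !addr0 Sb !eqxx.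
case/andP=> Sa st.
have -> : (s, a, t) = linfun D1_in a + (s *: D1_x + t *: D1_xs).
  rewrite lfunE /=; apply/eqP; rewrite !xpair_eqE /=.
  rewrite !scaler0 !addr0 !add0r.
  by rewrite /GRing.scale /= !mulr1 !eqxx.
apply: memv_add; first exact: memv_img.
case: i st {Sa} => [_|/= /andP[/eqP-> /eqP->]].
  by apply: memv_add; apply: memvZ; exact: memv_line.
by rewrite !scale0r addr0 mem0v.
Qed.

Lemma psignE i a : is_superspace S ->
  a \in spart S i -> psign S a = (-1) ^+ i *: a.
Proof.
case=> _ S0.
have S1 : (spart S true :&: spart S false)%VS = 0%VS by rewrite capvC.
have pi0 U W b : (U :&: W = 0)%VS -> b \in W -> daddv_pi (vT := A) U W b = 0.
  move=> UW Wb; have WU : (W :&: U = 0)%VS by rewrite capvC.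
  have Ub : b \in (U + W)%VS by rewrite -[b]add0r memv_add ?mem0v.
  have := daddv_pi_add UW Ub; rewrite (daddv_pi_id WU Wb).
  by move/(canRL (addrK _)); rewrite subrr.
rewrite /psign lfunE /= lfunE /=; case: i => Sa.
  by rewrite expr1 scaleN1r pi0 // daddv_pi_id // sub0r.
by rewrite expr0 scale1r daddv_pi_id // pi0 // subr0.
Qed.

Section Brackets.

Hypothesis hS : is_superspace S.
Hypothesis bilS : bilinear_for *:%R *:%R (sbr S).
Hypothesis bilW : bilinear_for *%R *%R omega.

Let br0r a : sbr S a 0 = 0.
Proof. by have := bilS.2 a (-1) 0 0; rewrite /= addr0 scaler0 scaleN1r addNr. Qed.
Let br0l a : sbr S 0 a = 0.
Proof. by have := bilS.1 a (-1) 0 0; rewrite /= addr0 scaler0 scaleN1r addNr. Qed.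
Let w0r a : omega a 0 = 0.
Proof. by have := bilW.2 a (-1) 0 0; rewrite /= addr0 scaler0 mulN1r addNr. Qed.
Let w0l a : omega 0 a = 0.
Proof. by have := bilW.1 a (-1) 0 0; rewrite /= addr0 scaler0 mulN1r addNr. Qed.
Let wZl k a b : omega (k *: a) b = k * omega a b.
Proof. by have := bilW.1 b k a 0; rewrite !addr0 w0l addr0. Qed.

Let simp := (linear0, br0r, br0l, w0r, w0l, scale0r, scaler0, scale1r, mul0r,
  mulr0, mulr1, oppr0, subr0, addr0, add0r, sub0r).

Lemma D1_br_in i a b : a \in spart S i ->
  D1_br (D1_in a) (D1_in b) =
  D1_in (sbr S a b) +
  (omega (D a) b + (-1) ^+ i * omega a (D b)) *: D1_x.
Proof.
move=> Sa; rewrite /D1_br /= ?simp /D1_bracket (psignE hS Sa) wZl.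
by apply/eqP; rewrite !xpair_eqE /= ?simp /GRing.scale /= mulr1 !eqxx.
Qed.

Lemma D1_br_x u : D1_br D1_x u = 0.
Proof.
case: u => [[s a] t]; rewrite /D1_br /= /D1_bracket /D1_xs_bracket ?simp.
by [].
Qed.

Lemma D1_br_xs_in a :
  D1_br D1_xs (D1_in a) = D1_in (D a) - omega a a0 *: D1_x.
Proof.
rewrite /D1_br /= /D1_bracket /D1_xs_bracket ?simp.
by apply/eqP; rewrite !xpair_eqE /= ?simp /GRing.scale /= mulr1 !eqxx.
Qed.

Lemma D1_br_xs_xs : D1_br D1_xs D1_xs = D1_in (2%:R *: a0).
Proof.
rewrite /D1_br /= /D1_bracket /D1_xs_bracket ?simp.
by apply/eqP; rewrite !xpair_eqE /= ?simp !eqxx.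
Qed.

Lemma D1_br_in_xs i a : a \in spart S i ->
  D1_br (D1_in a) D1_xs = - ((-1) ^+ i *: D1_br D1_xs (D1_in a)).
Proof.
move=> Sa; rewrite /D1_br /= /D1_bracket /D1_xs_bracket (psignE hS Sa) ?simp.
rewrite wZl linearZ.
by apply/eqP; rewrite !xpair_eqE /= ?simp /GRing.scale /= !mulrN !opprK !eqxx.
Qed.

End Brackets.

End Extension.

Section Isomorphism.

Variables (K : fieldType) (V W : vectType K).

Definition restricted_form_isomorphism
    (S : superdata V) (T : superdata W) (f : 'Hom(V, W)) : Prop :=
  [/\ lker f = 0%VS /\ limg f = fullv,
      forall i, (f @: spart S i)%VS = spart T i,
      forall a b, f (sbr S a b) = sbr T (f a) (f b),
      forall a, a \in spart S false -> f (spm S a) = spm T (f a)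
    & forall a b, sform T (f a) (f b) = sform S a b].

End Isomorphism.

Definition is_D1_extension (K : fieldType) (p : nat) (V A : vectType K)
    (G : superdata V) (S : superdata A) : Prop :=
  exists (D : 'End(A)) (a0 : A), is_D1_data p S D a0 /\
    exists f : 'Hom(V, D1_space A),
      restricted_form_isomorphism G (D1_extension S D a0) f.

(* Main.v *)
(** Since omega is closed and x is central, the orthogonal complement of x is an
    ideal containing [g, g] and the even part.  Choose an odd isotropic x^* with
    omega(x^*, x) = 1 and let a be the orthogonal complement of x and x^*, with
    the bracket of g projected along x and x^*, the form restricted, and the
    p-map unchanged, as the even parts of a and g coincide.  Then D is the
    projection of ad_(x^* ) and a_0 = [x^*, x^*] / 2; the identities relating
    omega, D and a_0 are closedness of omega at triples containing x^* or a_0,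
    and D^2 = ad_(a_0) is the Jacobi identity for (x^*, x^*, a).  The
    star-property of Delta is Jacobson's formula for the p-map, and D^* exists
    because omega is non-degenerate. *)

Require Import Defs.
From HB Require Import structures.
From mathcomp Require Import all_boot all_order all_algebra ring.

Set Implicit Arguments.
Unset Strict Implicit.
Unset Printing Implicit Defensive.

Import GRing.Theory.
Local Open Scope ring_scope.

(** Stated as a sigma type so that [sval] can extract the map in definitions such as [red_der] and
    [red_iso]. *)
Lemma lfun_exists (K : fieldType) (U W : vectType K) (g : U -> W) :
  linear g -> {h : 'Hom(U, W) | forall u, h u = g u}.
Proof.
move=> g_lin; pose G : {linear U -> W} :=
  HB.pack g (GRing.isLinear.Build _ _ _ _ g g_lin).
by exists (linfun G) => u; rewrite lfunE.
Qed.

(** * Bilinear maps, scalar forms and adjoints *)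

Section Bilinear.

Variables (K : fieldType) (V W : lmodType K) (B : V -> V -> W).
Hypothesis bilB : bilinear_for *:%R *:%R B.

Let Br a : {linear V -> W} :=
  HB.pack (B a) (GRing.isLinear.Build _ _ _ _ (B a) (bilB.2 a)).
Let Bl b : {linear V -> W} :=
  HB.pack (B^~ b) (GRing.isLinear.Build _ _ _ _ (B^~ b) (bilB.1 b)).

Lemma bil0r a : B a 0 = 0. Proof. exact: (linear0 (Br a)). Qed.
Lemma bil0l b : B 0 b = 0. Proof. exact: (linear0 (Bl b)). Qed.
Lemma bilDr a b c : B a (b + c) = B a b + B a c.
Proof. exact: (linearD (Br a)). Qed.
Lemma bilDl a b c : B (a + b) c = B a c + B b c.
Proof. exact: (linearD (Bl c)). Qed.
Lemma bilNr a b : B a (- b) = - B a b.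
Proof. exact: (linearN (Br a)). Qed.
Lemma bilNl a b : B (- a) b = - B a b.
Proof. exact: (linearN (Bl b)). Qed.
Lemma bilZr k a b : B a (k *: b) = k *: B a b.
Proof. exact: (linearZZ (Br a)). Qed.
Lemma bilZl k a b : B (k *: a) b = k *: B a b.
Proof. exact: (linearZZ (Bl b)). Qed.

End Bilinear.

Section Form.

Variables (K : fieldType) (V : vectType K) (w : V -> V -> K).
Hypothesis bilw : bilinear_for *%R *%R w.

(** Scaling in [K^o] is multiplication in [K], so scalar forms inherit the lemmas on vector-valued
    bilinear maps. *)
Let bilw' : bilinear_for *:%R *:%R (w : V -> V -> K^o) := bilw.

Lemma scalar_form0r a : w a 0 = 0. Proof. exact: (bil0r bilw' a). Qed.
Lemma scalar_form0l b : w 0 b = 0. Proof. exact: (bil0l bilw' b). Qed.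
Lemma scalar_formDr a b c : w a (b + c) = w a b + w a c.
Proof. exact: (bilDr bilw' a). Qed.
Lemma scalar_formDl a b c : w (a + b) c = w a c + w b c.
Proof. exact: (bilDl bilw' a). Qed.
Lemma scalar_formNr a b : w a (- b) = - w a b.
Proof. exact: (bilNr bilw' a). Qed.
Lemma scalar_formNl a b : w (- a) b = - w a b.
Proof. exact: (bilNl bilw' a). Qed.
Lemma scalar_formZr k a b : w a (k *: b) = k * w a b.
Proof. exact: (bilZr bilw' k a). Qed.
Lemma scalar_formZl k a b : w (k *: a) b = k * w a b.
Proof. exact: (bilZl bilw' k a). Qed.

(** Sending [b] to the functional [w(-, b)] embeds [V] in its dual, hence is bijective by dimension;
    [h b] is the vector representing [w(g -, b)]. *)
Lemma scalar_form_adjoint (g : 'End(V)) :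
  (forall b, (forall a, w a b = 0) -> b = 0) ->
  exists h : 'End(V), forall a b, w (g a) b = w a (h b).
Proof.
move=> ndw.
have w_lin b : linear (w^~ b : V -> K^o) by move=> k a c; exact: bilw'.1.
pose phi b := sval (lfun_exists (w_lin b)).
have phiE b a : phi b a = w a b by rewrite /phi; case: (lfun_exists _).
have phi_lin : linear phi.
  move=> k b c; apply/lfunP => a.
  by rewrite add_lfunE scale_lfunE !phiE; exact: bilw'.2.
have [Phi PhiE] := lfun_exists phi_lin.
have psi_lin : linear (fun b => (phi b \o g)%VF).
  by move=> k b c; rewrite phi_lin comp_lfunDl comp_lfunZl.
have [Psi PsiE] := lfun_exists psi_lin.
have Phi_inj : lker Phi == 0%VS.
  rewrite -subv0; apply/subvP => b; rewrite memv_ker memv0 => /eqP Phib0.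
  by apply/eqP/ndw => a; rewrite -phiE -PhiE Phib0 zero_lfunE.
have Phi_full : limg Phi = fullv.
  apply/eqP; rewrite eqEdim subvf /= limg_dim_eq ?(eqP Phi_inj) ?capv0 //.
  by rewrite !dimvf /dim /= muln1.
exists (Phi^-1 \o Psi)%VF => a b.
rewrite -[RHS]phiE -PhiE comp_lfunE /= limg_lfunVK ?Phi_full ?memvf //.
by rewrite PsiE comp_lfunE phiE.
Qed.

End Form.

(** * Words in two letters, and polynomial identities in characteristic p *)

Section Jacobson.

Lemma sum_tuple_cons (R : nmodType) n (F : seq bool -> R) :
  \sum_(w : n.+1.-tuple bool) F w =
  \sum_(w : n.-tuple bool) F (true :: w) +
  \sum_(w : n.-tuple bool) F (false :: w).
Proof.
rewrite (reindex (fun u : bool * n.-tuple bool => [tuple of u.1 :: u.2])) /=.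
  by rewrite -(pair_bigA _ (fun c (w : n.-tuple bool) => F (c :: w))) big_bool.
exists (fun w : n.+1.-tuple bool => (thead w, [tuple of behead w])).
  by move=> [c w] _; congr (_, _); apply: val_inj.
by move=> w _; rewrite [RHS]tuple_eta.
Qed.

Variables (K : fieldType) (V : lmodType K) (B : V -> V -> V).
Hypothesis bilB : bilinear_for *:%R *:%R B.

Lemma foldl_bil_add s c d : foldl B (c + d) s = foldl B c s + foldl B d s.
Proof. by elim: s c d => //= y s IH c d; rewrite (bilDl bilB) IH. Qed.

Lemma foldl_bil_scale s k c : foldl B (k *: c) s = k *: foldl B c s.
Proof. by elim: s c => //= y s IH c; rewrite (bilZl bilB) IH. Qed.

Lemma foldl_bil0 s : foldl B 0 s = 0.
Proof. by rewrite -[in LHS](scale0r (0 : V)) foldl_bil_scale scale0r. Qed.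

(** Multilinear expansion: each of the [n] slots chooses [a], contributing a factor [mu], or [b]. *)
Lemma foldl_nseq_expand n mu a b c :
  foldl B c (nseq n (mu *: a + b)) =
  \sum_(w : n.-tuple bool) mu ^+ count_mem true w *:
    foldl B c [seq if l then a else b | l <- w].
Proof.
elim: n c => [|n IH] c /=.
  rewrite (big_pred1 [tuple]) ?scale1r // => w.
  by apply/esym/eqP; exact: tuple0.
rewrite (sum_tuple_cons _ (fun w => mu ^+ count_mem true w *:
    foldl B c [seq if l then a else b | l <- w])) /=.
rewrite (bilDr bilB) (bilZr bilB) foldl_bil_add foldl_bil_scale !IH scaler_sumr.
by congr (_ + _); apply: eq_bigr => w _; rewrite scalerA -exprS.
Qed.

End Jacobson.

(** As [K] may be finite, degrees must stay below [p]: the images of 0, ..., p - 1 are then too many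
    roots for a nonzero [q - r]. *)
Lemma pchar_poly_ext (K : fieldType) p (q r : {poly K}) :
  p \in [pchar K] -> (size q <= p)%N -> (size r <= p)%N ->
  (forall mu, q.[mu] = r.[mu]) -> q = r.
Proof.
move=> charK sq sr qr; apply/eqP; rewrite -subr_eq0; apply/negPn/negP => nz.
pose rs : seq K := [seq i%:R | i <- iota 0 p].
have urs : uniq rs.
  rewrite map_inj_in_uniq ?iota_uniq // => i j; rewrite !mem_iota !add0n /=.
  wlog le_ij : i j / (i <= j)%N.
    by move=> H ip jp; case/orP: (leq_total i j) => ij E; [|symmetry]; apply: H.
  move=> _ jp E; have : (p %| j - i)%N.
    by rewrite (dvdn_pcharf charK) natrB // E subrr.
  case: (posnP (j - i)) => [/eqP|pos /(dvdn_leq pos)].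
    by rewrite subn_eq0 => ji _; apply/eqP; rewrite eqn_leq le_ij ji.
  by rewrite leqNgt (leq_ltn_trans (leq_subr _ _) jp).
have ars : all (root (q - r)) rs.
  by apply/allP => y _; rewrite rootE !hornerE qr subrr.
have := max_poly_roots nz ars urs; rewrite size_map size_iota.
by rewrite ltnNge (leq_trans (size_polyD _ _)) // size_polyN geq_max sq sr.
Qed.

(** * Homogeneous decomposition and Jacobson's formula *)

Section SuperSpace.

Variables (K : fieldType) (V : vectType K) (S : superdata V).
Hypothesis hS : is_superspace S.

(** Additive claims reduce to homogeneous vectors, where the sign rules are available. *)
Lemma superspace_ind (Q : V -> Prop) :
  (forall i a, a \in spart S i -> Q a) ->
  (forall a b, Q a -> Q b -> Q (a + b)) -> forall v, Q v.
Proof.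
move=> Qh QD v; have := memvf v; rewrite -hS.1 => /memv_addP[a Sa [b Sb ->]].
by apply: QD; apply: Qh; eassumption.
Qed.

End SuperSpace.

Section StarProperty.

Variables (K : fieldType) (V : vectType K) (S : superdata V).
Hypothesis lieS : is_lie_superalgebra S.

Let bilB : bilinear_for *:%R *:%R (sbr S). Proof. by case: lieS. Qed.

Lemma sbr_even a b : a \in spart S false -> b \in spart S false ->
  sbr S a b \in spart S false /\ sbr S a b = - sbr S b a.
Proof.
move=> Sa Sb; case: lieS => _ _ par _ _.
by have [] := par _ _ _ _ Sa Sb; rewrite scale1r.
Qed.

(** Anti-symmetry on the even part turns each left bracket with [z] into a right one at the cost of
    a sign, giving the left-normed form used in [star_property]. *)
Lemma iter_ad_foldl n z c : z \in spart S false -> c \in spart S false ->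
  iter n (sbr S z) c \in spart S false /\
  iter n (sbr S z) c = (-1) ^+ n *: foldl (sbr S) c (nseq n z).
Proof.
move=> Sz; elim: n c => [|n IH] c Sc; first by rewrite scale1r.
have [Szc zc] := sbr_even Sz Sc; have [S1 E1] := IH _ Szc.
rewrite iterSr; split=> //; rewrite E1 zc -scaleN1r (foldl_bil_scale bilB).
by rewrite scalerA -exprSr.
Qed.

(* The words starting with [a, a] contribute nothing, and p - 1 is even, so
   (ad_(mu a + b))^(p - 1) (a) is a sum of left-normed brackets weighted by
   powers of mu; comparing coefficients expresses s_i(a, b) through them. *)
Lemma p_structure_star_property p (alpha : V -> V -> K) (beta : V -> K)
    (phi : {linear V -> K^o}) :
  p \in [pchar K] -> (2 < p)%N -> is_p_structure p S ->
  (forall a b, alpha a b = phi (sbr S a b)) ->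
  (forall a, a \in spart S false -> beta a = phi (spm S a)) ->
  star_property p S alpha beta.
Proof.
move=> charK p_gt2 [_ _ pZ pD] alphaE betaE; split=> [t a Sa|a b Sa Sb].
  by rewrite !betaE ?memvZ // pZ // linearZZ.
have [s [sE pDs]] := pD a b Sa Sb.
rewrite !betaE ?memvD // pDs !linearD linear_sum {pD pDs pZ}; congr (_ + _).
have pr : prime p by case/andP: charK.
have p_neq0 i : (i < p.-1)%N -> i.+1%:R != 0 :> K.
  move=> ip; rewrite -(dvdn_pcharf charK) gtnNdvd //.
  by rewrite -(prednK (prime_gt0 pr)).
have p_odd : odd p by case: (even_prime pr) => // p2; rewrite p2 in p_gt2.
(* Now p = m + 3: [m.+2] letters follow the first [a], and [m.+1] follow [[a, b]]. *)
case: p charK p_gt2 sE pr p_neq0 p_odd => [|[|[|m]]] // charK _ sE _ pn0 p_odd.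
have aa0 : sbr S a a = 0.
  have /eqP := (sbr_even Sa Sa).2; rewrite -addr_eq0 -mulr2n -scaler_nat.
  by rewrite scaler_eq0 (negPf (pn0 1%N isT)) => /eqP.
pose L (w : seq bool) : K :=
  phi (foldl (sbr S) (sbr S a b) [seq if l then a else b | l <- w]).
have wordE (w : m.+1.-tuple bool) :
    [seq if nth false w i then a else b | i <- iota 0 m.+1] =
    [seq if l then a else b | l <- w].
  rewrite (map_comp (fun l : bool => if l then a else b)) map_nth_iota0.
    by rewrite take_oversize ?size_tuple.
  by rewrite size_tuple.
(* Here [w] lists the letters after [[a, b]]; the leading [a] accounts for the successor in the
   count. *)
transitivity (\sum_(w : m.+1.-tuple bool) (count_mem true w).+1%:R^-1 * L w).
  (* As polynomials in [mu], [q1] comes from the identity defining the s_i and [q2] from the word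
     expansion, both after applying [phi]. *)
  pose q1 : {poly K} := \poly_(i < m.+2) (i.+1%:R * phi (s i.+1)).
  pose q2 : {poly K} :=
    \sum_(w : m.+1.-tuple bool) L w *: 'X^(count_mem true w).
  have cw (w : m.+1.-tuple bool) : (count_mem true w < m.+2)%N.
    by rewrite ltnS (leq_trans (count_size _ _)) ?size_tuple.
  have q12 : q1 = q2.
    apply: (pchar_poly_ext charK); first exact: leq_trans (size_poly _ _) _.
      apply: (leq_trans (size_sum _ _ _)); apply/bigmax_leqP => w _.
      by rewrite (leq_trans (size_scale_leq _ _)) // size_polyXn ltnW // ltnS.
    move=> mu; have := congr1 phi (sE mu).
    have Sz : mu *: a + b \in spart S false by rewrite memvD ?memvZ.
    rewrite (iter_ad_foldl m.+2 Sz Sa).2 -signr_odd.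
    have -> : odd m.+2 = false by move: p_odd => /=; case: (odd m).
    rewrite expr0 scale1r (foldl_nseq_expand bilB m.+2).
    rewrite (sum_tuple_cons _ (fun w => mu ^+ count_mem true w *:
      foldl (sbr S) a [seq if l then a else b | l <- w])) big1 ?add0r;
      last first.
      move=> w _ /=; rewrite aa0.
      by rewrite (foldl_bil0 bilB) scaler0.
    rewrite !linear_sum big_add1 big_mkord /q1 /q2 horner_poly horner_sum => E.
    transitivity (\sum_(i < m.+2) phi ((i.+1%:R * mu ^+ i) *: s i.+1)).
      by apply: eq_bigr => i _; rewrite linearZZ mulrAC.
    rewrite -E; apply: eq_bigr => w _.
    by rewrite linearZZ hornerZ hornerXn mulrC.
  rewrite big_add1 big_mkord.
  (* The coefficient of [q1] at degree [i] is (i + 1) phi(s_(i+1)), and i + 1 < p is invertible. *)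
  have sE' (i : 'I_m.+2) : phi (s i.+1) =
      \sum_(w : m.+1.-tuple bool)
        i.+1%:R^-1 * (L w * (val i == count_mem true w)%:R).
    rewrite -mulr_sumr; apply: (canRL (mulKf (pn0 _ (ltn_ord i)))).
    have := congr1 (fun q : {poly K} => q`_i) q12.
    rewrite coef_poly ltn_ord => ->; rewrite coef_sum.
    by apply: eq_bigr => w _; rewrite coefZ coefXn.
  rewrite (eq_bigr _ (fun i _ => sE' i)) exchange_big /=.
  apply: eq_bigr => w _; rewrite (bigD1 (Ordinal (cw w))) //= eqxx mulr1.
  rewrite big1 ?addr0 // => i; rewrite -val_eqE /= => /negPf->.
  by rewrite !mulr0.
(* Peeling off two letters leaves only the words starting with [a], [b], as the summation condition
   demands. *)
rewrite [RHS]big_mkcond [RHS](sum_tuple_cons _ (fun w =>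
  if nth false w 0 && ~~ nth true w 1 then
    let x i := if nth false w i then a else b in
    (count_mem true w)%:R^-1 *
    alpha (foldl (sbr S) (x 0%N) [seq x i | i <- iota 1 m.+1]) (x m.+2)
  else 0)) /=.
rewrite [X in _ + X]big1 // addr0.
rewrite (sum_tuple_cons _ (fun w => if ~~ nth true w 0
  then (true + count_mem true w)%:R^-1 *
    alpha (foldl (sbr S) (sbr S a (if nth false w 0 then a else b))
      [seq (if nth false (true :: w) i then a else b) | i <- iota 2 m])
      (if nth false w m.+1 then a else b)
  else 0)) /= [X in X + _]big1 ?add0r //.
apply: eq_bigr => w _; rewrite add1n add0n alphaE /L -wordE; congr (_ * phi _).
(* The last letter of [w] is the second argument of [alpha]; the positions of the others are shifted
   by the two peeled letters. *)
rewrite -[in iota _ _]addn1 iotaD map_cat foldl_cat /= add0n.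
by congr (sbr S (foldl _ _ _) _); rewrite (iotaDl 2 0) -map_comp.
Qed.

End StarProperty.

(** * The superalgebra on the orthogonal complement of [x] and [xs] *)

Section Reduction.

Variables (K : fieldType) (p : nat) (V : vectType K) (G : superdata V).
Hypotheses (charK : p \in [pchar K]) (p_gt2 : (2 < p)%N).
Hypothesis hG : is_restricted_orthosymplectic_qF p G.

Local Notation br := (sbr G).
Local Notation w := (sform G).

Variables x xs : V.
Hypotheses (x_central : in_center G x) (x_odd : x \in spart G true).
Hypotheses (xs_odd : xs \in spart G true) (wxx : w x x = 0).
Hypotheses (wss : w xs xs = 0) (wsx : w xs x = 1).

(* A is the orthogonal complement of x and x^*, with inclusion J and
   orthogonal projection P. *)
Variables (A : vectType K) (J : 'Hom(A, V)) (P : 'Hom(V, A)).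
Hypothesis JK : cancel J P.
Hypothesis PK : forall v, J (P v) = v - w xs v *: x - w x v *: xs.

Let lieG : is_lie_superalgebra G. Proof. by case: hG => [[]]. Qed.
Let spG : is_superspace G. Proof. by case: lieG. Qed.
Let bilB : bilinear_for *:%R *:%R (sbr G). Proof. by case: lieG. Qed.
Let bilw : bilinear_for *%R *%R w. Proof. by case: hG => _ []. Qed.

Let brE := (bilDr bilB, bilDl bilB, bilNr bilB, bilNl bilB, bilZr bilB,
  bilZl bilB, bil0r bilB, bil0l bilB).
Let wE := (scalar_formDr bilw, scalar_formDl bilw, scalar_formNr bilw,
  scalar_formNl bilw, scalar_formZr bilw, scalar_formZl bilw,
  scalar_form0r bilw, scalar_form0l bilw).

Let two_neq0 : 2%:R != 0 :> K.
Proof. by rewrite -(dvdn_pcharf charK) gtnNdvd. Qed.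

Lemma br_part i j a b : a \in spart G i -> b \in spart G j ->
  br a b \in spart G (i (+) j).
Proof. by case: lieG => _ _ par _ _ Ga Gb; case: (par _ _ _ _ Ga Gb). Qed.

Lemma br_anti i j a b : a \in spart G i -> b \in spart G j ->
  br a b = - ((-1) ^+ (i && j) *: br b a).
Proof. by case: lieG => _ _ par _ _ Ga Gb; case: (par _ _ _ _ Ga Gb). Qed.

Lemma w_anti i j a b : a \in spart G i -> b \in spart G j ->
  w a b = - ((-1) ^+ (i && j) * w b a).
Proof. by case: hG => _ [_ _ _ anti _] _; exact: anti. Qed.

Lemma w_even0 i j a b : a \in spart G i -> b \in spart G j -> i != j ->
  w a b = 0.
Proof. by case: hG => _ _ ev; exact: ev. Qed.

Lemma w_closed i j k a b c :
  a \in spart G i -> b \in spart G j -> c \in spart G k ->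
  (-1) ^+ (i && k) * w a (br b c) + (-1) ^+ (k && j) * w c (br a b) +
  (-1) ^+ (j && i) * w b (br c a) = 0.
Proof. by case: hG => _ [_ _ _ _ cl] _; exact: cl. Qed.

(** Between odd elements super anti-symmetry is symmetry; against even ones both sides vanish. *)
Lemma w_odd_sym y v : y \in spart G true -> w v y = w y v.
Proof.
move=> Gy; elim/(superspace_ind spG): v => [[] a Ga|a b IHa IHb].
- by rewrite (w_anti Ga Gy) mulN1r opprK.
- by rewrite (w_even0 Ga Gy) // (w_even0 Gy Ga).
- by rewrite !wE IHa IHb.
Qed.

Lemma br_x v : br v x = 0.
Proof.
elim/(superspace_ind spG): v => [i a Ga|a b IHa IHb].
  by rewrite (br_anti Ga x_odd) x_central scaler0 oppr0.
by rewrite !brE IHa IHb addr0.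
Qed.

(** In closedness at (x, u, v) the two terms bracketing with the central [x] vanish. *)
Lemma w_x_br u v : w x (br u v) = 0.
Proof.
elim/(superspace_ind spG): u => [i a Ga|a b IHa IHb]; last first.
  by rewrite !(brE, wE) IHa IHb addr0.
elim/(superspace_ind spG): v => [j b Gb|b c IHb IHc]; last first.
  by rewrite !(brE, wE) IHb IHc addr0.
have := w_closed x_odd Ga Gb; rewrite x_central br_x !wE !mulr0 !addr0 => /eqP.
by rewrite mulf_eq0 signr_eq0 => /eqP.
Qed.

Lemma w_xs_even v : v \in spart G false -> w xs v = 0.
Proof. by move=> Gv; apply: (w_even0 xs_odd Gv). Qed.

Lemma w_x_even v : v \in spart G false -> w x v = 0.
Proof. by move=> Gv; apply: (w_even0 x_odd Gv). Qed.

(** Even vectors are orthogonal to the odd [x] and [xs], so the projection fixes them; this is why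
    the p-map carries over. *)
Lemma JP_even v : v \in spart G false -> J (P v) = v.
Proof. by move=> Gv; rewrite PK w_xs_even ?w_x_even // !scale0r !subr0. Qed.

Lemma P_x : P x = 0.
Proof.
rewrite -[LHS]JK PK wxx wsx scale1r scale0r subr0 subrr.
by rewrite linear0.
Qed.

Lemma w_x_J a : w x (J a) = 0.
Proof.
by rewrite -[a]JK PK !wE wxx (w_odd_sym x xs_odd) wsx; ring.
Qed.

Lemma w_xs_J a : w xs (J a) = 0.
Proof. by rewrite -[a]JK PK !wE wss wsx; ring. Qed.

Lemma w_J_x a : w (J a) x = 0.
Proof. by rewrite (w_odd_sym _ x_odd) w_x_J. Qed.

Lemma w_J_xs a : w (J a) xs = 0.
Proof. by rewrite (w_odd_sym _ xs_odd) w_xs_J. Qed.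

Lemma w_J_JP a v : w (J a) (J (P v)) = w (J a) v.
Proof. by rewrite PK !wE w_J_x w_J_xs; ring. Qed.

Lemma w_JP_J a v : w (J (P v)) (J a) = w v (J a).
Proof. by rewrite PK !wE w_x_J w_xs_J; ring. Qed.

(* The complement of x is A + K x and x is central, so the bracket does not
   see the projection. *)
Lemma br_JPr u v : w x v = 0 -> br u (J (P v)) = br u v.
Proof.
by move=> xv; rewrite PK xv !brE br_x !(scaler0, scale0r, subr0, oppr0). Qed.

Lemma br_JPl u v : w x v = 0 -> br (J (P v)) u = br v u.
Proof.
by move=> xv; rewrite PK xv !brE x_central !(scaler0, scale0r, subr0, oppr0).
Qed.

Lemma P_part i v : v \in spart G i -> J (P v) \in spart G i.
Proof.
case: i => Gv; last by rewrite JP_even.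
by rewrite PK !rpredB ?rpredZ.
Qed.

(** [superdata] lives on a whole space, so the structure is transported to [A] by [J] and [P] rather
    than kept on a subspace of [V]. *)
Definition red : superdata A :=
  SuperData (fun i => J @^-1: spart G i)%VS
    (fun a b => P (br (J a) (J b))) (fun a => P (spm G (J a)))
    (fun a b => w (J a) (J b)).

Lemma red_part i a : (a \in spart red i) = (J a \in spart G i).
Proof. by rewrite memv_preim. Qed.

Lemma red_superspace : is_superspace red.
Proof.
split.
  apply/eqP; rewrite eqEsubv subvf; apply/subvP => a _.
  have := memvf (J a); rewrite -spG.1 => /memv_addP[b Gb [c Gc E]].
  rewrite -[a]JK E linearD memv_add // red_part; exact: P_part.
apply/eqP; rewrite -subv0; apply/subvP => a; rewrite memv_cap !red_part => Ga.
have : J a \in (spart G false :&: spart G true)%VS by rewrite memv_cap.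
by rewrite spG.2 !memv0 => /eqP Ja0; rewrite -[a]JK Ja0 linear0.
Qed.

(** Inner brackets are orthogonal to [x], so their projection drops out and each identity is [P]
    applied to the one in [G]. *)
Lemma red_lie : is_lie_superalgebra red.
Proof.
split; first exact: red_superspace.
- split=> [b k a c | a k b c] /=; first by rewrite linearP bilB.1 linearP.
  by rewrite linearP bilB.2 linearP.
- move=> i j a b; rewrite !red_part /= => Ga Gb; split.
    by apply: P_part; apply: br_part.
  by rewrite (br_anti Ga Gb) linearN linearZZ.
- move=> i j k a b c; rewrite !red_part /= => Ga Gb Gc.
  rewrite !br_JPr ?br_JPl ?w_x_br // -linearZZ -linearD; congr (P _).
  by case: lieG => _ _ _ jac _; exact: jac Ga Gb Gc.
move=> u; rewrite red_part /= => Gu.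
rewrite br_JPr ?w_x_br //.
by case: lieG => _ _ _ _ cub; rewrite cub // linear0.
Qed.

(** The hypothesis serves the first bracket; later ones act on brackets, which are already
    orthogonal to [x]. *)
Lemma iter_red_br a v n : w x v = 0 ->
  iter n (sbr red a) (P v) = P (iter n (sbr G (J a)) v).
Proof.
move=> xv; elim: n => [|n IH] //; rewrite !iterS IH /= br_JPr //.
by case: n {IH} => [|n] //=; rewrite w_x_br.
Qed.

Lemma red_p2p : is_p2p_map p red.
Proof.
have [[pG _ pZ pD] pAd] : is_p2p_map p G by case: hG => [[]].
have adp a b : a \in spart red false ->
    sbr red (spm red a) b = iter p (sbr red a) b.
  rewrite red_part => Ga; rewrite -[b in RHS]JK iter_red_br ?w_x_J // -pAd //=.
  by rewrite JP_even // pG.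
split=> //; split=> [a|a b Ga _|t a|a b] /=.
- by rewrite !red_part => Ga; apply: P_part; apply: pG.
- exact: adp.
- by rewrite red_part => Ga; rewrite linearZZ pZ // linearZZ.
rewrite !red_part => Ga Gb; have [s [sE pDs]] := pD _ _ Ga Gb.
exists (P \o s); split=> [mu|]; last first.
  by rewrite linearD pDs !linearD linear_sum.
rewrite -[a in iter _ _ a]JK iter_red_br ?w_x_J // linearP sE linear_sum.
by apply: eq_bigr => i _; rewrite linearZZ.
Qed.

Lemma red_qF : is_restricted_orthosymplectic_qF p red.
Proof.
split; first by split; [exact: red_lie | exact: red_p2p].
  split=> /=; first exact: red_lie.
  - by split=> [b k a c|a k b c]; rewrite linearP ?bilw.1 ?bilw.2.
  - move=> a wa0; rewrite -[a]JK.
    suff -> : J a = 0 by rewrite linear0.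
    case: hG => _ [_ _ nd _ _] _; apply: nd => v.
    (* Pairing with [J a] sees only the component in [A], so non-degeneracy descends. *)
    by rewrite -w_J_JP wa0.
  - by move=> i j a b; rewrite !red_part /=; exact: w_anti.
  move=> i j k a b c; rewrite !red_part /= => Ga Gb Gc.
  by rewrite !w_J_JP; exact: w_closed.
by move=> i j a b; rewrite !red_part /=; exact: w_even0.
Qed.

Let redB : bilinear_for *:%R *:%R (sbr red). Proof. by case: red_lie. Qed.
Let redW : bilinear_for *%R *%R (sform red).
Proof. by case: red_qF => _ [] . Qed.
Let redP := red_superspace.

(** * The odd derivation and the element a_0 *)

Fact red_der_linear : linear (fun a => P (br xs (J a))).
Proof. by move=> k a b; rewrite linearP bilB.2 linearP. Qed.

Definition red_der : 'End(A) := sval (lfun_exists red_der_linear).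

Lemma red_derE a : red_der a = P (br xs (J a)).
Proof. by rewrite /red_der; case: (lfun_exists _). Qed.

Definition red_a0 : A := P (2%:R^-1 *: br xs xs).

Lemma J_a0 : J red_a0 = 2%:R^-1 *: br xs xs.
Proof. by rewrite JP_even // rpredZ // (br_part xs_odd xs_odd). Qed.

Lemma a0_even : red_a0 \in spart red false.
Proof. by rewrite red_part J_a0 rpredZ // (br_part xs_odd xs_odd). Qed.

Lemma br_xs_xs v : br xs (br xs v) = br (J red_a0) v.
Proof.
elim/(superspace_ind spG): v => [i a Ga|a b IHa IHb]; last first.
  by rewrite !brE IHa IHb.
have := lieG => -[_ _ _ jac _]; have /eqP := jac _ _ _ _ _ _ xs_odd xs_odd Ga.
rewrite expr1 scaleN1r -subr_eq opprK -mulr2n -scaler_nat J_a0 !brE => /eqP <-.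
by rewrite scalerA mulVf // scale1r.
Qed.

(** This is the coefficient of [x] in [[xs, v]]. For even [v] it is half of closedness at (xs, xs,
    v); for odd [v] both sides vanish by parity. *)
Lemma w_xs_br_xs v : w xs (br xs v) = - w (J (P v)) (J red_a0).
Proof.
elim/(superspace_ind spG): v => [i a Ga|a b IHa IHb]; last first.
  by rewrite !(brE, wE, linearD) IHa IHb opprD.
case: i Ga => Ga.
  rewrite (w_xs_even (br_part xs_odd Ga)).
  by rewrite (w_even0 (P_part Ga) (_ : _ \in spart G false)) ?oppr0 //
     -red_part a0_even.
rewrite JP_even // J_a0 wE.
have := w_closed xs_odd xs_odd Ga.
rewrite (br_anti Ga xs_odd) !wE /= !expr0 expr1 !mul1r mulN1r opprK => E.
apply: (mulfI two_neq0); rewrite mulrN mulrA divff // mul1r.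
by apply/eqP; rewrite -subr_eq0 -E; apply/eqP; ring.
Qed.

Lemma spm_even u : u \in spart G false -> spm G u \in spart G false.
Proof. by case: hG => [[_ [[pG _ _ _] _]] _ _]; exact: pG. Qed.

(** Write the left side as minus the p-th power of ad_u applied to [xs]; the innermost bracket
    absorbs the sign. *)
Lemma br_xs_spm u : u \in spart G false ->
  br xs (spm G u) = iter p.-1 (br u) (br xs u).
Proof.
move=> Gu; have pAd : forall b, br (spm G u) b = iter p (br u) b.
  by case: hG => [[_ [_ pAd]] _ _] b; exact: pAd.
rewrite (br_anti xs_odd (spm_even Gu)) (br_anti xs_odd Gu) /= !expr0 !scale1r.
rewrite pAd -[in LHS](prednK (ltnW (ltnW p_gt2))) iterSr.
elim: (p.-1) => [|n IH] //.
by rewrite iterS [RHS]iterS -IH brE.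
Qed.

Lemma red_der_part i a : a \in spart red i ->
  red_der a \in spart red (i (+) true).
Proof.
rewrite red_derE !red_part => Ga; rewrite addbC.
by apply: P_part; apply: br_part.
Qed.

Lemma red_der_derivation : is_restricted_derivation p red true red_der.
Proof.
split; first split; first exact: red_der_part.
  move=> i a b; rewrite red_part !red_derE /= => Ga.
  rewrite !br_JPr ?br_JPl ?w_x_br // -linearZZ -linearD; congr (P _).
  (* A derivation is tested on arbitrary [b], while the Jacobi identity needs homogeneous
     arguments. *)
  elim/(superspace_ind spG): (J b) => [j c Gc|c d IHc IHd]; last first.
    by rewrite !brE IHc IHd scalerDr addrACA.
  rewrite andbT.
  by case: lieG => _ _ _ jac _; rewrite (jac _ _ _ _ _ _ xs_odd Ga Gc).
move=> a; rewrite red_part !red_derE /= => Ga.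
by rewrite JP_even ?spm_even // br_xs_spm // iter_red_br ?w_x_br.
Qed.

(* The coefficient of x in [a, b], from closedness at (x^*, a, b). *)
Lemma w_xs_br_J a b :
  w xs (br (J a) (J b)) =
  w (J (red_der a)) (J b) + w (J (psign red a)) (J (red_der b)).
Proof.
rewrite !red_derE w_JP_J w_J_JP.
elim/(superspace_ind redP): a => [i a Sa|a c IHa IHc]; last first.
  by rewrite !(linearD, brE, wE) IHa IHc addrACA.
elim/(superspace_ind redP): b => [j b Sb|b c IHb IHc]; last first.
  by rewrite !(linearD, brE, wE) IHb IHc addrACA.
rewrite (psignE redP Sa) linearZZ wE.
move: Sa Sb; rewrite !red_part => Ga Gb.
have Gsa := br_part xs_odd Ga; have Gsb := br_part xs_odd Gb.
(* For equal parities every term pairs an odd with an even element and vanishes. *)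
case: (eqVneq i j) => [ij|ij].
  rewrite -ij in Gb Gsb; have := br_part Ga Gb; rewrite addbb => /w_xs_even->.
  by rewrite (w_even0 Gsa Gb) ?(w_even0 Ga Gsb) ?mulr0 ?addr0 //; case: (i).
have := w_closed xs_odd Ga Gb; rewrite (w_anti Gb Gsa) (br_anti Gb xs_odd) !wE.
case: i j ij Ga Gb Gsa Gsb => [] [] //= _ _ _ _ _; rewrite ?expr0 ?expr1 => E;
  apply/eqP; rewrite -subr_eq0.
  by rewrite -E; apply/eqP; ring.
by rewrite -oppr_eq0 -E; apply/eqP; ring.
Qed.

(** Closedness at (a_0, a, b), prepared for comparison with [Omega]. *)
Lemma w_J_a0_br a b i : a \in spart red i -> b \in spart red i ->
  w (J red_a0) (br (J a) (J b)) =
  w (br (J red_a0) (J a)) (J b) - (-1) ^+ i * w (br (J red_a0) (J b)) (J a).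
Proof.
rewrite !red_part => Ga Gb; have G0 : J red_a0 \in spart G false.
  by rewrite -red_part a0_even.
have := w_closed G0 Ga Gb; rewrite (br_anti Gb G0) !wE.
rewrite (w_anti Gb (br_part G0 Ga)) (w_anti Ga (br_part G0 Gb)) /= andbF andbb.
case: i {Ga Gb} => /=; rewrite ?expr0 ?expr1 => E; apply/eqP; rewrite -subr_eq0;
  by rewrite -E; apply/eqP; ring.
Qed.

Lemma red_der_sq a : red_der (red_der a) = sbr red red_a0 a.
Proof. by rewrite !red_derE /= br_JPr ?w_x_br // br_xs_xs. Qed.

(** This is the cubic axiom for the odd element [xs]. *)
Lemma red_der_a0 : red_der red_a0 = 0.
Proof.
rewrite red_derE J_a0 brE.
by case: lieG => _ _ _ _ cub; rewrite cub // scaler0 linear0.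
Qed.

(** The form is even, so only the component of [a] with the parity of [b] counts and fixes the
    sign. *)
Lemma w_swap j a b : b \in spart red j ->
  w (J a) (J b) = - ((-1) ^+ j * w (J b) (J a)).
Proof.
move=> Sb; elim/(superspace_ind redP): a => [i a Sa|a c IHa IHc]; last first.
  by rewrite !(linearD, wE) IHa IHc mulrDr opprD.
move: Sa Sb; rewrite !red_part => Ga Gb.
case: (eqVneq i j) => [ij|ij]; first by rewrite (w_anti Ga Gb) ij andbb.
by rewrite (w_even0 Ga Gb) // (w_even0 Gb Ga) ?mulr0 ?oppr0 // eq_sym.
Qed.

(** Composing the derivation with [psign] absorbs the sign, leaving an ordinary adjoint. *)
Lemma red_adjoint : exists Ds : 'End(A), is_adjoint red true red_der Ds.
Proof.
have [_ [_ _ nd _ _] _] := red_qF.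
have [|Ds DsE] := @scalar_form_adjoint _ _ _ redW (red_der \o psign red)%VF.
  (* Non-degeneracy passes from the first argument to the second by [w_swap]. *)
  move=> b b0; apply: nd => a.
  elim/(superspace_ind redP): a => [i a Sa|a c IHa IHc].
    by rewrite /= (w_swap _ Sa) (b0 a : w (J a) (J b) = 0) mulr0 oppr0.
  by rewrite (scalar_formDr redW) IHa IHc addr0.
exists Ds => i a b Sa; rewrite andbT -DsE comp_lfunE /= (psignE redP Sa).
by rewrite !linearZZ wE mulrA -expr2 sqrr_sign mul1r.
Qed.

(** * The pair (Omega, Delta) as a coboundary *)

Section Adjoint.

Variable Ds : 'End(A).
Hypothesis DsP : is_adjoint red true red_der Ds.

Lemma red_Omega a b : Omega red red_der Ds a b = w (J red_a0) (br (J a) (J b)).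
Proof.
(* Moving [Ds] across twice costs the sign (-1)^i (-1)^(i + 1) = -1, and turns it into the squared
   derivation, which is ad of a_0. *)
have sq i c d : c \in spart red i ->
    w (J c) (J (Ds (Ds d))) = - w (br (J red_a0) (J c)) (J d).
  move=> Sc; have /= E1 := DsP (Ds d) Sc; have /= E2 := DsP d (red_der_part Sc).
  rewrite red_der_sq /= w_JP_J E1 in E2; rewrite E2 !andbT.
  by case: (i); rewrite /= ?expr0 ?expr1; ring.
rewrite /Omega /= linearB !wE red_der_sq /= w_JP_J.
elim/(superspace_ind redP): a => [i a Sa|a c IHa IHc]; last first.
  by rewrite !(linearD, brE, wE, opprD) -IHa -IHc addrACA.
elim/(superspace_ind redP): b => [j b Sb|b c IHb IHc]; last first.
  by rewrite !(linearD, brE, wE, opprD) -IHb -IHc addrACA.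
rewrite (w_swap _ Sb) (sq j) //.
case: (eqVneq i j) => [ij|ij].
  by rewrite -ij in Sb *; rewrite (w_J_a0_br Sa Sb); ring.
have := a0_even; move: Sa Sb; rewrite !red_part => Ga Gb G0.
rewrite (w_even0 (br_part G0 Ga) Gb) //.
rewrite (w_even0 (br_part G0 Gb) Ga) 1?eq_sym //.
rewrite (w_even0 G0 (br_part Ga Gb)); first by ring.
by case: i j ij {Ga Gb} => [] [].
Qed.

(** The left side is the coefficient of [x] in [[a, c]], where c = (ad_a)^(p-2)(D a). By [br_xs_spm]
    that bracket is [xs] with the p-th power of [a], whose coefficient is a pairing with a_0. *)
Lemma red_Delta a : a \in spart red false ->
  Delta p red red_der Ds a = w (J red_a0) (J (spm red a)).
Proof.
move=> Sa; rewrite /Delta; set c := iter _ _ _.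
have cE : c = P (iter p.-2 (br (J a)) (br xs (J a))).
  by rewrite /c red_derE iter_red_br // w_x_br.
have Sc : c \in spart red true.
  rewrite /c; elim: p.-2 => [|n IH]; first exact: (red_der_part Sa).
  rewrite iterS; case: red_lie => _ _ par _ _.
  exact: (par _ _ _ _ Sa IH).1.
transitivity (w xs (br (J a) (J c))).
  rewrite w_xs_br_J (psignE redP Sa) expr0 scale1r /= linearD wE; congr (_ + _).
  rewrite (w_swap _ Sc) (w_swap _ (red_der_part Sc)) /= expr1 expr0.
  by have /= -> := DsP a Sc; rewrite expr1; ring.
rewrite cE br_JPr; last by case: p.-2 => [|n]; rewrite w_x_br.
rewrite -iterS prednK; last by case: (p) p_gt2 => [|[]].
rewrite red_part in Sa; rewrite -br_xs_spm // w_xs_br_xs /=.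
rewrite [RHS](w_swap (j := false)) ?expr0 ?mul1r // red_part.
by apply: P_part; apply: spm_even.
Qed.

Lemma red_B2star :
  in_B2star p red (Omega red red_der Ds) (Delta p red red_der Ds).
Proof.
have phi_lin : linear (fun a => w (J red_a0) (J a) : K^o).
  by move=> k a b; rewrite linearP bilw.2.
pose phi : {linear A -> K^o} := HB.pack (fun a => w (J red_a0) (J a) : K^o)
  (GRing.isLinear.Build _ _ _ _ _ phi_lin).
have OmegaE a b : Omega red red_der Ds a b = phi (sbr red a b).
  by rewrite red_Omega /= w_J_JP.
split.
- split=> [b k a c|a k b c]; rewrite !OmegaE; first by rewrite redB.1 linearP.
  by rewrite redB.2 linearP.
- move=> i j a b Sa Sb; rewrite !OmegaE.
  case: red_lie => _ _ par _ _; rewrite (par _ _ _ _ Sa Sb).2.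
  by rewrite linearN linearZZ.
- apply: (p_structure_star_property red_lie charK p_gt2 red_p2p.1 OmegaE).
  exact: red_Delta.
by exists phi; split=> //; exact: red_Delta.
Qed.

End Adjoint.

Lemma red_D1_data : is_D1_data p red red_der red_a0.
Proof.
split; first exact: red_der_derivation.
have [Ds DsP] := red_adjoint; exists Ds => //; split; first exact: red_B2star.
split; [exact: a0_even| |exact: red_Delta|exact: red_der_sq|exact: red_der_a0].
by move=> a b; rewrite red_Omega //= w_J_JP.
Qed.

(** * The isomorphism with the extension *)

Fact red_iso_linear : linear (fun v => (w xs v, P v, w x v) : D1_space A).
Proof. by move=> k u v; rewrite !bilw.2 linearP. Qed.

(** As [x] and [xs] are isotropic and dual, pairing with one reads the coordinate along the
    other. *)
Definition red_iso : 'Hom(V, D1_space A) := sval (lfun_exists red_iso_linear).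

Lemma red_isoE v : red_iso v = (w xs v, P v, w x v).
Proof. by rewrite /red_iso; case: (lfun_exists _). Qed.

Lemma hyperbolic_split v : v = w xs v *: x + J (P v) + w x v *: xs.
Proof. by rewrite PK -addrA subrK addrC subrK. Qed.

Lemma red_iso_surj s a t : red_iso (s *: x + J a + t *: xs) = (s, a, t).
Proof.
rewrite red_isoE !wE w_xs_J w_x_J wsx wss wxx (w_odd_sym x xs_odd) wsx.
rewrite !linearD !linearZZ /= JK P_x.
have -> : P xs = 0 by rewrite -[LHS]JK PK wss (w_odd_sym x xs_odd) wsx
  scale0r scale1r subr0 subrr linear0.
by rewrite !(scaler0, mulr0, mulr1, addr0, add0r).
Qed.

Lemma br_J_xs a : br (J a) xs = - br xs (J (psign red a)).
Proof.
elim/(superspace_ind redP): a => [i a Sa|a c IHa IHc]; last first.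
  by rewrite (linearD J) brE IHa IHc !linearD brE opprD.
rewrite (psignE redP Sa) linearZZ brE; rewrite red_part in Sa.
by rewrite (br_anti Sa xs_odd) andbT.
Qed.

(** Terms containing the central [x] vanish; the remaining four match those of [D1_br]. *)
Lemma br_split u v : br u v =
  br (J (P u)) (J (P v)) + w x u *: br xs (J (P v)) -
  w x v *: br xs (J (psign red (P u))) + (w x u * w x v) *: br xs xs.
Proof.
rewrite {1}(hyperbolic_split u) {1}(hyperbolic_split v) !brE.
rewrite !x_central !br_x br_J_xs.
by rewrite !scaler0 !(add0r, addr0) scalerN scalerA [w x v * _]mulrC !addrA.
Qed.

Lemma P_br u v : P (br u v) =
  sbr red (P u) (P v) + w x u *: red_der (P v) -
  w x v *: red_der (psign red (P u)) + (w x u * w x v) *: (2%:R *: red_a0).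
Proof.
rewrite br_split !(linearD P) (linearN P) !(linearZZ P) /= !red_derE.
congr (_ + _ *: _).
by rewrite /red_a0 (linearZZ P) /= scalerA divff // scale1r.
Qed.

Lemma red_isoP :
  restricted_form_isomorphism G (D1_extension red red_der red_a0) red_iso.
Proof.
split.
- split.
    apply/eqP; rewrite -subv0; apply/subvP => v.
    rewrite memv_ker memv0 red_isoE => /eqP[v1 v2 v3].
    by rewrite [v]hyperbolic_split v1 v2 v3 linear0 !scale0r !addr0.
  apply/eqP; rewrite eqEsubv subvf; apply/subvP => -[[s a] t] _.
  by rewrite -red_iso_surj memv_img ?memvf.
- move=> i; apply/eqP; rewrite eqEsubv; apply/andP; split; apply/subvP.
    move=> _ /memv_imgP[v Gv ->].
    rewrite red_isoE mem_D1_part /= red_part P_part //=.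
    by case: i Gv => //= Gv; rewrite w_xs_even ?w_x_even ?eqxx.
  move=> [[s a] t]; rewrite mem_D1_part /= red_part => /andP[Ga st].
  rewrite -red_iso_surj memv_img //.
  case: i st Ga => [_|/= /andP[/eqP-> /eqP->]] Ga; last first.
    by rewrite !scale0r add0r addr0.
  by rewrite !rpredD ?rpredZ.
- move=> u v; rewrite !red_isoE.
  apply/eqP; rewrite !xpair_eqE -andbA; apply/and3P; split; apply/eqP => /=.
  (* The coordinate along [x]: the even [[xs, xs]] is orthogonal to [xs] and drops out. *)
  + rewrite br_split !wE w_xs_br_J (w_xs_even (br_part xs_odd xs_odd)).
    by rewrite !w_xs_br_xs !JK.
  + exact: P_br.
  by rewrite w_x_br !(scaler0, subr0, addr0).
- move=> a Ga; have [[pG _ _ _] _] : is_p2p_map p G by case: hG => [[]].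
  by rewrite !red_isoE /= JP_even // w_xs_even ?w_x_even ?pG.
move=> u v; rewrite !red_isoE /= [in RHS](hyperbolic_split u).
rewrite [in RHS](hyperbolic_split v) !wE.
rewrite wxx wss wsx (w_odd_sym x xs_odd) wsx w_xs_J w_x_J w_J_x w_J_xs; ring.
Qed.

End Reduction.

(** * Choice of [xs] and assembly *)

Lemma isotropic_partner (K : fieldType) p (V : vectType K) (G : superdata V) x :
  p \in [pchar K] -> (2 < p)%N -> is_restricted_orthosymplectic_qF p G ->
  x != 0 -> x \in spart G true -> sform G x x = 0 ->
  exists xs, [/\ xs \in spart G true, sform G xs xs = 0 & sform G xs x = 1].
Proof.
move=> charK p_gt2 hG x_neq0 x_odd wxx.
have [[[spG _ _ _ _] _] [_ bilw nd _ _] ev] := hG.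
have w_lin : linear (sform G x : V -> K^o) by exact: bilw.2.
have [h hE] := lfun_exists w_lin.
have : h != 0.
  apply: contraNneq x_neq0 => h0; apply/eqP/nd => b.
  by rewrite -[LHS]hE h0 zero_lfunE.
case/lfunPn=> b; rewrite hE zero_lfunE.
(* The even component of [b] pairs to zero with [x], so the odd component [d] pairs nontrivially. *)
have := memvf b; rewrite -spG.1 => /memv_addP[c Gc [d Gd ->]].
rewrite (scalar_formDr bilw) (ev _ _ _ _ x_odd Gc) // add0r => wxd.
(* [k] normalizes the pairing with [x], and [l] solves k^2 omega(d, d) + 2 l = 0, making
   [k *: d + l *: x] isotropic. *)
pose k := (sform G x d)^-1; pose l := - (2%:R^-1 * (k * (k * sform G d d))).
have two_neq0 : 2%:R != 0 :> K by rewrite -(dvdn_pcharf charK) gtnNdvd.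
have kd : k * sform G x d = 1 by rewrite mulVf.
have wdx : sform G d x = sform G x d by rewrite (w_odd_sym hG _ x_odd).
exists (k *: d + l *: x); rewrite rpredD ?rpredZ //; split=> //.
  rewrite !(scalar_formDr bilw, scalar_formDl bilw).
  rewrite !(scalar_formZr bilw, scalar_formZl bilw) wdx wxx.
  have -> : l * (k * sform G x d) = l by rewrite kd mulr1.
  by rewrite [k * (l * _)]mulrCA kd /l; field.
by rewrite (scalar_formDl bilw) !(scalar_formZl bilw) wxx wdx kd mulr0 addr0.
Qed.

Theorem theorem3p5 (K : fieldType) (p : nat)
  (charK : p \in [pchar K]) (p_gt2 : (2 < p)%N)
  (V : vectType K) (G : superdata V)
  (hG : is_restricted_orthosymplectic_qF p G)
  (hx : exists x : V, [/\ x != 0, in_center G x, x \in spart G true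
                        & sform G x x = 0]) :
  exists (A : vectType K) (S : superdata A),
    is_restricted_orthosymplectic_qF p S /\ is_D1_extension p G S.
Proof.
have [x [x_neq0 x_central x_odd wxx]] := hx.
have [xs [xs_odd wss wsx]] := isotropic_partner charK p_gt2 hG x_neq0 x_odd wxx.
have [_ [_ bilw _ _ _] _] := hG.
have wxs : sform G x xs = 1 by rewrite (w_odd_sym hG _ xs_odd).
have w_lin a : linear (sform G a : V -> K^o) by exact: bilw.2.
have [hs hsE] := lfun_exists (w_lin xs); have [h hE] := lfun_exists (w_lin x).
(* [U] is the orthogonal complement of [x] and [xs], and [q] the projection onto it; [subvs_of U]
   turns it into a space of its own. *)
pose U := (lker hs :&: lker h)%VS.
pose q v := v - sform G xs v *: x - sform G x v *: xs.
have qU v : q v \in U.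
  rewrite memv_cap !memv_ker hsE hE /q.
  rewrite !(scalar_formDr bilw, scalar_formNr bilw, scalar_formZr bilw).
  by rewrite wxx wss wsx wxs !(mulr0, mulr1, subr0, subrr) eqxx.
have q_lin : linear q.
  move=> k u v; rewrite /q !bilw.2 !scalerDl -!scalerA !opprD.
  rewrite !scalerBr [X in X + _ = _]addrACA.
  by rewrite [LHS]addrACA.
have P_lin : linear (vsproj U \o q) by move=> k u v; rewrite /= q_lin linearP.
have [P PE] := lfun_exists P_lin.
have [J JE] := lfun_exists (@vsval_is_linear _ _ U).
have JK : cancel J P.
  move=> a; have := subvsP a.
  rewrite memv_cap !memv_ker hsE hE => /andP[/eqP sa /eqP xa].
  by rewrite PE JE /= /q sa xa !scale0r !subr0 vsvalK.
have PK v : J (P v) = q v by rewrite JE PE /= vsprojK.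
exists (subvs_of U), (red G J P).
split; first exact: (red_qF hG x_central x_odd xs_odd wxx wss wsx JK PK).
exists (red_der hG xs J P), (red_a0 G xs P); split; first exact: red_D1_data.
by exists (red_iso hG x xs P); exact: red_isoP.
Qed.
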